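(* Let $H \in \mathbb{N}$ and $m_1, \ldots, m_H \in \mathbb{Z}$. Then there exist sets $A,B \subseteq \left[0,60H^2 \sum_{h=1}^H |m_h|\right]$, each of size at most $2+60H \sum_{h=1}^H |m_h|$, such that $$|hA|-|hB|=m_h$$ for each $1 \leq h \leq H$.
   Context: $\mathbb{N}$ denotes the positive integers. For integers $a \leq b$, $[a,b]:=\{a,a+1,\ldots,b\}$ denotes the integer interval, so $A,B$ are sets of integers. For a subset $A$ of an abelian group and $h \in \mathbb{N}$, the $h$-fold iterated sumset is $hA:=\{a_1+\cdots+a_h : a_1,\ldots,a_h \in A\}$ (repetitions allowed); here the group is $\mathbb{Z}$. $|X|$ denotes the cardinality of a finite set $X$, and $|m|$ the absolute value of an integer $m$. *)

(* Defs.v *)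
From HB Require Import structures.
From mathcomp Require Import all_boot all_order all_algebra.
From mathcomp Require Import finmap.

Set Implicit Arguments.
Unset Strict Implicit.
Unset Printing Implicit Defensive.

Import GRing.Theory.
Local Open Scope fset_scope.
Local Open Scope ring_scope.

(* hA = { a_1 + ... + a_h : a_1, ..., a_h \in A }: [a] ranges over the
   functions from 'I_h to the finite type of elements of A, so repetitions
   are allowed. *)
Definition sumset (V : zmodType) (h : nat) (A : {fset V}) : {fset V} :=
  [fset \sum_(i < h) fsval (a i) | a : {ffun 'I_h -> A} in predT].

(* Main.v *)
Require Import Defs.
From HB Require Import structures.
From mathcomp Require Import all_boot all_order all_algebra.
From mathcomp Require Import finmap.
From mathcomp Require Import zify.

Set Implicit Arguments.
Unset Strict Implicit.
Unset Printing Implicit Defensive.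

Import GRing.Theory.
Local Open Scope fset_scope.
Local Open Scope ring_scope.

(* Fix steps d_1, ..., d_r >= 0, let P be the set of partial sums
   q, q + d_1, q + d_1 + d_2, ..., with maximum l, and take
   A = {0, 1} u P u [l, N].  If l <= 2q, two elements of A that are at least
   q add up to at least l, and if 2l <= N, the multiples of [l, N] fill up
   [l, hN], so that
   hA = [0, h] u (P + [0, h - 1]) u [l, hN].  If also h < q, this is the
   disjoint union of [0, h], of the intervals of length min(d_i, h) that start
   at the points of P other than the last, and of [l, hN], so
   |hA| = (h + 1) + sum_i min(d_i, h) + (hN + 1 - l).
   Replacing a pair of steps (k, k) by (k + 1, k - 1) keeps l, and changes
   |hA| only when h = k, in which case it lowers it by exactly 1.  So
   take |m_k| pairs (k, k) in A against |m_k| pairs (k + 1, k - 1) in B for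
   every k, exchanging the roles of A and B when m_k < 0. *)

Lemma sumset0 (V : zmodType) (A : {fset V}) : sumset 0 A = [fset 0].
Proof.
apply/fsetP => x; rewrite inE; apply/imfsetP/eqP => [[a _ ->]|->].
  by rewrite big_ord0.
have a0 (i : 'I_0) : A by case: i.
by exists (finfun a0); rewrite ?big_ord0.
Qed.

Lemma sumsetSP (V : zmodType) (h : nat) (A : {fset V}) (x : V) :
  reflect (exists y z, [/\ y \in sumset h A, z \in A & x = y + z])
          (x \in sumset h.+1 A).
Proof.
apply: (iffP idP) => [/imfsetP[a _ ->]|[y [z [/imfsetP[a _ ->] zA ->]]]].
  rewrite big_ord_recr /=.
  exists (\sum_(i < h) fsval (a (widen_ord (leqnSn h) i))), (fsval (a ord_max)).
  split=> //.
  apply/imfsetP; exists [ffun i => a (widen_ord (leqnSn h) i)] => //.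
  by apply: eq_bigr => i _; rewrite ffunE.
(* [insub] fails only at the index [h], where the default [z] becomes the last summand. *)
apply/imfsetP; exists [ffun i => oapp a [` zA] (insub (val i))] => //.
rewrite big_ord_recr /= ffunE insubN /= ?ltnn //; congr (_ + _).
by apply: eq_bigr => i _; rewrite ffunE /= valK.
Qed.

Lemma sumset1 (V : zmodType) (A : {fset V}) : sumset 1 A = A.
Proof.
apply/fsetP => x; apply/sumsetSP/idP => [[y [z []]]|xA].
  by rewrite sumset0 inE => /eqP -> zA ->; rewrite add0r.
by exists 0, x; rewrite sumset0 inE eqxx add0r.
Qed.

Definition points (q : nat) (d : seq nat) : seq nat := q :: scanl addn q d.

Lemma points_cons q x d : points q (x :: d) = q :: points (q + x) d.
Proof. by []. Qed.

Lemma points_bounds q d p : p \in points q d -> (q <= p <= q + sumn d)%N.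
Proof.
elim: d q => [|x d IH] q; first by rewrite inE => /eqP ->; rewrite addn0 leqnn.
rewrite points_cons inE => /predU1P[->|/IH] /=; lia.
Qed.

Lemma mem_points_last q d : (q + sumn d)%N \in points q d.
Proof.
elim: d q => [|x d IH] q; first by rewrite addn0 inE.
by rewrite points_cons inE addnA IH orbT.
Qed.

(** Each interval [[p, p + h - 1]] is cut off at the next point, so that nothing is listed twice; a
    step 0 gives an empty block. The last point gets no block, as [[l, hN]] starts there. *)
Fixpoint blocks (h q : nat) (d : seq nat) : seq nat :=
  if d is x :: d' then iota q (minn x h) ++ blocks h (q + x) d' else [::].

Lemma size_blocks h q d : size (blocks h q d) = (\sum_(x <- d) minn x h)%N.
Proof.
elim: d q => [|x d IH] q; first by rewrite big_nil.
by rewrite big_cons size_cat size_iota IH.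
Qed.

(** The cuts lose nothing: a number of [[p, p + h - 1]] that reaches the next point [p'] also lies
    in [[p', p' + h - 1]], because [p <= p']. *)
Lemma mem_blocks h q d n :
  (n \in blocks h q d) =
  (n < q + sumn d)%N && has (fun p => p <= n < p + h)%N (points q d).
Proof.
elim: d q => [|x d IH] q; first by rewrite /= in_nil; lia.
rewrite /= mem_cat mem_iota IH -/(points _ _) /=; set s := has _ _.
lia.
Qed.

Lemma uniq_blocks h q d : uniq (blocks h q d).
Proof.
elim: d q => [|x d IH] q //=; rewrite cat_uniq iota_uniq IH andbT.
apply/hasPn => n; rewrite mem_blocks => /andP[_ /hasP[p /points_bounds]].
by rewrite mem_iota; lia.
Qed.

Definition comb (h N q : nat) (d : seq nat) : seq nat :=
  iota 0 h.+1 ++ blocks h q d ++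
  iota (q + sumn d) ((h * N).+1 - (q + sumn d)).

Definition combset (N q : nat) (d : seq nat) : {fset int} :=
  [fset x in map Posz (comb 1 N q d)].

Section Comb.

Variables (N q : nat) (d : seq nat).
Hypothesis q_gt0 : (0 < q)%N.
Hypothesis le_last_2q : (q + sumn d <= 2 * q)%N.
Hypothesis le_2last_N : (2 * (q + sumn d) <= N)%N.

Lemma mem_comb h n : (0 < h)%N ->
  (n \in comb h N q d) =
  [|| n <= h, has (fun p => p <= n < p + h) (points q d)
    | q + sumn d <= n <= h * N]%N.
Proof.
move=> h0; rewrite !mem_cat !mem_iota mem_blocks.
case: hasP => [[p /points_bounds pP pn]|_]; nia.
Qed.

Lemma combS h (n : nat) : (0 < h)%N ->
  n \in comb h.+1 N q d <->
  exists y z, [/\ y \in comb h N q d, z \in comb 1 N q d & n = y + z]%N.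
Proof.
move=> h0; have lP := mem_points_last q d; set l := (q + sumn d)%N in lP *.
split=> [|[y [z [+ + ->]]]].
  rewrite mem_comb // => /or3P[nh|/hasP[p pP pn]|/andP[ln nN]].
  - exists (n - (n == h.+1))%N, (n == h.+1 : nat).
    by rewrite !mem_comb //; split; lia.
  - exists (n - p)%N, p; rewrite !mem_comb //; split; try lia.
    by apply/or3P/Or32/hasP; exists p => //; lia.
  (* The middle range [h * N < n < l + N] occurs only for [h = 1]; there [n - l] lies in [[l, N]]
     because [2 * l <= N]. *)
  pose z := if (n <= h * N)%N then 0%N else if (l + N <= n)%N then N else l.
  have zn : (z <= n)%N by rewrite /z; do !case: ifP; nia.
  exists (n - z)%N, z; rewrite !mem_comb // -/l subnK //; split=> //; last first.
    by rewrite /z; do !case: ifP => ?; apply/or3P;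
       [apply: Or31 | apply: Or33; nia | apply: Or33; nia].
  by apply/or3P/Or33; rewrite /z; do !case: ifP => ?; nia.
rewrite !mem_comb //.
case/or3P=> [yh|/hasP[p pP py]|/andP[ly yN]];
  case/or3P=> [z1|/hasP[r rP rz]|/andP[lz zN]];
  try by apply/or3P/Or33; nia.
- by apply/or3P/Or31; lia.
- by apply/or3P/Or32/hasP; exists r => //; lia.
- by apply/or3P/Or32/hasP; exists p => //; lia.
(* Both summands are at least [q], so [y + z >= 2 * q >= l]. *)
- have := points_bounds pP; have := points_bounds rP => ? ?.
  case: (ltnP (y + z) (p + h.+1)) => ?.
    by apply/or3P/Or32/hasP; exists p => //; lia.
  by apply/or3P/Or33; nia.
- by have := points_bounds pP => ?; apply/or3P/Or33; nia.
- by have := points_bounds rP => ?; apply/or3P/Or33; nia.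
Qed.

Lemma sumset_combset h : (0 < h)%N ->
  sumset h (combset N q d) = [fset x in map Posz (comb h N q d)].
Proof.
elim: h => // h IH _; case: (posnP h) => [->|hp]; first by rewrite sumset1.
apply/fsetP => x; apply/sumsetSP/idP => [[y [z []]]|].
  rewrite IH // !in_fset => /mapP[i iC ->] /mapP[j jC ->] ->.
  rewrite -PoszD; apply: map_f; apply/combS => //.
  by exists i, j.
rewrite in_fset => /mapP[n /(combS _ hp)[i [j [iC jC ->]]] ->].
by exists (Posz i), (Posz j); rewrite IH // !in_fset !map_f // PoszD.
Qed.

Lemma card_sumset_combset h : (0 < h < q)%N ->
  #|` sumset h (combset N q d)| =
  (h.+1 + \sum_(x <- d) minn x h + ((h * N).+1 - (q + sumn d)))%N.
Proof.
case/andP=> h0 hq; rewrite sumset_combset // card_fseq undup_id.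
  by rewrite size_map !size_cat !size_iota size_blocks addnA.
rewrite map_inj_uniq; last by move=> ? ? [].
rewrite !cat_uniq !iota_uniq uniq_blocks !andTb !andbT; apply/andP; split.
  apply/hasPn => n; rewrite mem_cat !mem_iota mem_blocks => nP.
  suff qn : (q <= n)%N by lia.
  case/orP: nP => [/andP[_ /hasP[p /points_bounds]]|]; lia.
by apply/hasPn => n; rewrite !mem_iota mem_blocks; lia.
Qed.

Lemma combset_sub x : x \in combset N q d -> 0 <= x <= N%:Z.
Proof.
rewrite in_fset => /mapP[n + ->]; rewrite mem_comb //.
by case/or3P => [|/hasP[p /points_bounds]|]; lia.
Qed.

End Comb.

Lemma leq_sum_minn1 d : (\sum_(x <- d) minn x 1 <= sumn d)%N.
Proof. by rewrite sumnE; apply: leq_sum => x _; rewrite geq_minl. Qed.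

Definition step_pair (b : bool) (k : nat) : seq nat :=
  if b then [:: k; k] else [:: k.+1; k.-1].

(** [b = true] gives A and [b = false] gives B; comparing the sign of [m k] with [b] exchanges the
    two pairs when [m k < 0]. *)
Definition steps (b : bool) (H : nat) (m : nat -> int) : seq nat :=
  flatten [seq flatten (nseq `|m k|%N (step_pair ((0 <= m k) == b) k))
          | k <- index_iota 1 H.+1].

Lemma sum_steps (F : nat -> nat) b H m :
  (\sum_(x <- steps b H m) F x =
   \sum_(1 <= k < H.+1)
     `|m k|%N * \sum_(x <- step_pair ((0 <= m k)%R == b) k) F x)%N.
Proof.
rewrite big_flatten big_map; apply: eq_bigr => k _.
rewrite big_flatten; elim: `|m k|%N => [|n IH]; first by rewrite big_nil.
by rewrite big_cons IH mulSn.
Qed.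

(** Both pairs sum to [2 * k] since [k >= 1]. The value is free of [b], so A and B share the last
    point [l]. *)
Lemma sumn_steps b H m :
  sumn (steps b H m) = (\sum_(1 <= k < H.+1) `|m k|%N * (2 * k))%N.
Proof.
rewrite sumnE sum_steps; apply: eq_big_nat => k /andP[k0 _]; congr (_ * _)%N.
by case: eqP => _; rewrite /step_pair !big_cons big_nil; lia.
Qed.

(** For fixed [h], [2 min(k, h) - min(k + 1, h) - min(k - 1, h)] is minus a second difference in [k]
    of a function whose only kink is at [k = h], where it equals 1. *)
Lemma sum_minn_steps H m h : (1 <= h <= H)%N ->
  (\sum_(x <- steps true H m) minn x h)%N%:Z -
  (\sum_(x <- steps false H m) minn x h)%N%:Z = m h.
Proof.
move=> hH; rewrite !sum_steps !(big_morph Posz PoszD (erefl 0%:Z)) -sumrB.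
rewrite (eq_big_nat _ _ (F2 := fun k => if k == h then m k else 0)).
  rewrite (bigD1_seq h) ?mem_index_iota ?iota_uniq //= eqxx big1 ?addr0 //.
  by move=> k /negPf ->.
move=> k /andP[k0 _].
by case: (boolP (0 <= m k)) => mk; rewrite /step_pair /= !big_cons !big_nil;
   case: eqP => ?; nia.
Qed.

Theorem theorem1p2 (H : nat) (hH : (0 < H)%N) (m : nat -> int) :
  exists A B : {fset int},
    [/\ {subset A <= `[0, 60 * H%:Z ^+ 2 * \sum_(1 <= h < H.+1) `|m h|]},
        {subset B <= `[0, 60 * H%:Z ^+ 2 * \sum_(1 <= h < H.+1) `|m h|]},
        #|` A|%:Z <= 2 + 60 * H%:Z * \sum_(1 <= h < H.+1) `|m h|,
        #|` B|%:Z <= 2 + 60 * H%:Z * \sum_(1 <= h < H.+1) `|m h| &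
        forall h : nat, (1 <= h <= H)%N ->
          #|` sumset h A|%:Z - #|` sumset h B|%:Z = m h].
Proof.
have -> : \sum_(1 <= h < H.+1) `|m h| = (\sum_(1 <= h < H.+1) `|m h|%N)%N%:Z.
  by rewrite (big_morph Posz PoszD (erefl 0%:Z)); apply: eq_bigr.
set M := (\sum_(1 <= h < H.+1) _)%N.
case: (posnP M) => [M0|Mpos].
  (* All [m h] vanish, so equal sets will do; the construction below needs [M > 0] to have
     [H < q]. *)
  exists fset0, fset0; split=> // h hh; rewrite subrr.
  move/eqP: M0; rewrite sum_nat_seq_eq0 => /allP/(_ h).
  by rewrite mem_index_iota => /(_ hh) /eqP; lia.
(* The steps sum to at most [2 * H * M], as [k <= H]; hence [l <= 2 * q] and
   [2 * l <= 4 * q = N]. *)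
pose q := (2 * H * M)%N; pose N := (8 * H * M)%N.
have sumE b : (sumn (steps b H m) <= q)%N.
  rewrite sumn_steps /q /M mulnC big_distrl /= big_nat_cond [leqRHS]big_nat_cond.
  by apply: leq_sum => k /andP[kH _]; nia.
have l2q b : (q + sumn (steps b H m) <= 2 * q)%N by have := sumE b; lia.
have lN b : (2 * (q + sumn (steps b H m)) <= N)%N.
  by have := sumE b; rewrite /q /N; lia.
have Hq : (H < q)%N by rewrite /q; nia.
have q0 : (0 < q)%N by lia.
pose S b := combset N q (steps b H m).
have subS b : {subset S b <= `[0, 60 * H%:Z ^+ 2 * M%:Z]}.
  move=> x /(combset_sub q0 (l2q b) (lN b)).
  by rewrite in_itv /= /N expr2; nia.
have cardS b : #|` S b|%:Z <= 2 + 60 * H%:Z * M%:Z.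
  (* With [s] the sum of the steps, the formula at [h = 1] gives at most
     [2 + s + (N + 1 - q - s) = 3 + 6 * H * M]. *)
  rewrite -[S b]sumset1 (card_sumset_combset q0 (l2q b) (lN b)); last by lia.
  have := leq_sum_minn1 (steps b H m); have := sumE b; rewrite /q /N; nia.
exists (S true), (S false); split=> // h hh.
rewrite -(sum_minn_steps m hh) !card_sumset_combset //; try lia.
by rewrite !sumn_steps; lia.
Qed.
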